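(* Let $s$ and $t$ be positive integers. Then $$\frac{H_{s}(\lambda)}{\left(H_{st}(\lambda)\right)^{t}}$$ is an integer for all partitions $\lambda$.
   Context: A partition $\lambda=(\lambda_1,\dots,\lambda_d)$ is a weakly decreasing finite sequence of positive integers (possibly empty), identified with its Young diagram. For a box $\square$ of the Young diagram, the hook based at $\square$ is the set of boxes consisting of $\square$ itself, the boxes of the diagram exactly to the right of $\square$ in its row, and the boxes exactly below $\square$ in its column. The hook length $h(\square)$ is the number of boxes in this hook. Let $\mathcal{H}(\lambda)$ denote the multiset of hook lengths of all boxes of $\lambda$. For a positive integer $r$, define the multiset (with repetitions) $\mathcal{H}_r(\lambda)=\{h/r : h\in\mathcal{H}(\lambda),\ r\mid h\}$, and let $H_r(\lambda)$ be the product of the elements of $\mathcal{H}_r(\lambda)$, counted with multiplicity (the empty product is $1$). *)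

(* Defs.v *)
From mathcomp Require Import all_boot all_order all_algebra.

Set Implicit Arguments.
Unset Strict Implicit.
Unset Printing Implicit Defensive.

Definition is_partition (la : seq nat) : bool :=
  sorted geq la && all (fun k => 0 < k) la.

(* Boxes are pairs (row, column), both counted from 0, in English notation:
   row 0 is at the top and has length la_1. *)
Definition diagram (la : seq nat) : seq (nat * nat) :=
  [seq (i, j) | i <- iota 0 (size la), j <- iota 0 (nth 0 la i)].

Definition hook (la : seq nat) (b : nat * nat) : seq (nat * nat) :=
  [seq c <- diagram la | (c.1 == b.1) && (b.2 <= c.2)
                      || (c.2 == b.2) && (b.1 <= c.1)].

Definition hook_length (la : seq nat) (b : nat * nat) : nat :=
  size (hook la b).

(* Multisets of natural numbers are represented by sequences. *)
Definition hook_lengths (la : seq nat) : seq nat :=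
  [seq hook_length la b | b <- diagram la].

Definition hook_quotients (r : nat) (la : seq nat) : seq nat :=
  [seq h %/ r | h <- hook_lengths la & r %| h].

Definition hook_prod (r : nat) (la : seq nat) : nat :=
  \prod_(h <- hook_quotients r la) h.

Lemma hook_length_gt0 la b : b \in diagram la -> 0 < hook_length la b.
Proof.
move=> b_la; rewrite /hook_length /hook size_filter -has_count.
by apply/hasP; exists b => //=; rewrite eqxx leqnn.
Qed.

(* Hence a quotient with denominator [hook_prod r la ^ t] is never a division
   by 0. *)
Lemma hook_prod_gt0 r la : 0 < r -> 0 < hook_prod r la.
Proof.
move=> r_gt0; rewrite /hook_prod big_seq.
apply: prodn_cond_gt0 => k /mapP[h]; rewrite mem_filter.
case/andP=> r_h /mapP[b b_la def_h] ->.
by rewrite divn_gt0 // dvdn_leq // def_h hook_length_gt0.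
Qed.

(* Main.v *)
Require Import Defs.
From mathcomp Require Import all_boot all_order all_algebra.
From mathcomp Require Import zify.

Set Implicit Arguments.
Unset Strict Implicit.
Unset Printing Implicit Defensive.

(** Why the integer is there: for a prime [p], the [p]-adic valuation of
    [hook_prod s la] is the sum over [k >= 1] of the number of hooks whose
    length is divisible by [s * p ^ k], and that of [hook_prod (s * t) la ^ t]
    is [t] times the sum over [k >= 1] of the number of hooks whose length is
    divisible by [s * t * p ^ k].  So it is enough to compare term by term,
    with [r = s * p ^ k]: at least [t] times as many hook lengths are divisible
    by [r] as by [r * t] ([count_dvd_hook_lengths_mul]).

    This inequality is clear from rim hooks, the number of hooks divisible by
    [r] being the [r]-weight, since a rim hook of length [r * t] can be peeled
    off as [t] rim hooks of length [r].  The proof here is a computation with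
    the beads of the partition, i.e. the first-column hook lengths.  The hook
    lengths in the row of the bead [x] are the numbers [x - y] where [y < x] is
    not a bead ([beads_gaps]).  Among the [y < x] exactly [x %/ r] are congruent
    to [x] modulo [r]; hence the number of hooks divisible by [r] is the sum of
    all [x %/ r], minus the number of pairs of beads that are congruent modulo
    [r] ([count_dvd_hook_lengths]).

    Since [x %/ r = t * (x %/ (r * t)) + x %/ r %% t], the inequality becomes a
    bound on congruent pairs ([residue_pairs_refine]).  Each class modulo [r] is
    the disjoint union of [t] classes modulo [r * t]; if the [c]-th of them
    contains [m c] beads, the bound is [leq_bin2_sum]. *)

(** * Pairs in a class and in its subclasses *)

Lemma leq_mul_bin2 a b : a * b <= 'C(a, 2) + 'C(b, 2) + b.
Proof.
have bin2E n : 'C(n, 2) * 2 + n = n * n.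
  by case: n => // n; rewrite -[X in _ * X]/(2`!) bin_ffact ffactnS ffactn1 /=; lia.
have := bin2E a; have := bin2E b.
have [/subnKC<- | /ltnW/subnKC<-] := leqP a b.
  by move: (b - a) => d; nia.
by move: (a - b) => [|d]; nia.
Qed.

(** The excess of the right side over the left is, for a [t]-runner abacus with
    [m c] beads on runner [c], the size of its [t]-core.  It is nonnegative
    because every cross term [m c * m c'] with [c < c'] is at most
    ['C(m c, 2) + 'C(m c', 2) + m c']: in the sum over all pairs [c < c'], each
    ['C(m c, 2)] occurs [t - 1] times and [m c'] occurs [c'] times. *)
Lemma leq_bin2_sum t (m : nat -> nat) :
  'C(\sum_(0 <= c < t) m c, 2)
    <= \sum_(0 <= c < t) c * m c + t * \sum_(0 <= c < t) 'C(m c, 2).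
Proof.
elim: t => [|t IHt]; first by rewrite !big_geq.
rewrite !big_nat_recr //=.
have cross : (\sum_(0 <= c < t) m c) * m t
    <= \sum_(0 <= c < t) 'C(m c, 2) + t * ('C(m t, 2) + m t).
  rewrite big_distrl /= -[X in X * (_ + _)]subn0 -sum_nat_const_nat -big_split.
  by apply: leq_sum => c _ /=; rewrite addnA leq_mul_bin2.
have bin2D a b : 'C(a + b, 2) = 'C(a, 2) + 'C(b, 2) + a * b.
  by elim: a => [|a IHa]; rewrite ?addn0 // addSn !binS IHa !bin1; lia.
rewrite bin2D; nia.
Qed.

Lemma sum_count_fiber (f F : nat -> nat) n (X : seq nat) :
    (forall x, f x < n) ->
  \sum_(0 <= c < n) F c * count (fun x => f x == c) X = \sum_(x <- X) F (f x).
Proof.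
move=> f_lt; elim: X => [|x X IHX] /=.
  by rewrite big_nil big1 // => c _; rewrite muln0.
rewrite big_cons -IHX; under eq_bigr do rewrite mulnDr.
rewrite big_split /=; congr (_ + _).
rewrite (bigD1_seq (f x)) ?mem_index_iota ?iota_uniq //= eqxx muln1.
by rewrite big1 ?addn0 // => c; rewrite eq_sym => /negPf->; rewrite muln0.
Qed.

Definition residue_count r (X : seq nat) a := count (fun x => x %% r == a) X.

(** Residues modulo [r * t] are written [a + c * r] with [a < r] and [c < t], so
    that [c] is the value of [x %/ r %% t] on that class; for each [a],
    [leq_bin2_sum] applies to the sizes of the [t] classes. *)
Lemma residue_pairs_refine r t (X : seq nat) : 0 < r -> 0 < t ->
  \sum_(0 <= a < r) 'C(residue_count r X a, 2)
    <= \sum_(x <- X) x %/ r %% t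
       + t * \sum_(0 <= b < r * t) 'C(residue_count (r * t) X b, 2).
Proof.
move=> r_gt0 t_gt0; have rt_gt0 : 0 < r * t by rewrite muln_gt0 r_gt0.
pose m a c := residue_count (r * t) X (a + c * r).
have blocks (F : nat -> nat) : \sum_(0 <= b < r * t) F b
    = \sum_(0 <= a < r) \sum_(0 <= c < t) F (a + c * r).
  rewrite mulnC big_nat_mul exchange_big_nat /=; apply: eq_bigr => c _.
  by rewrite mulSn -{1}[c * r]add0n big_addn addnK.
have digits x : x %% (r * t) = x %% r + x %/ r %% t * r.
  rewrite mulnC modn_divl [RHS]addnC.
  by rewrite -(modn_dvdm x (dvdn_mull t (dvdnn r))) -divn_eq.
have residue_split a : a < r ->
    residue_count r X a = \sum_(0 <= c < t) m a c.
  move=> a_lt; transitivity (\sum_(x <- [seq x <- X | x %% r == a]) 1).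
    by rewrite sum1_size size_filter.
  rewrite -(@sum_count_fiber (fun x => x %/ r %% t) (fun=> 1) t); last first.
    by move=> x; rewrite ltn_mod.
  apply: eq_bigr => c _; rewrite mul1n count_filter; apply: eq_count => x /=.
  rewrite digits; apply/andP/eqP => [[/eqP-> /eqP->] // | eq_ac].
  have eq_a : x %% r = a.
    have := congr1 (modn^~ r) eq_ac.
    by rewrite ![_ + _ * r]addnC !modnMDl modn_mod (modn_small a_lt).
  by move/eqP: eq_ac; rewrite eq_a eqxx eqn_add2l eqn_pmul2r.
have -> : \sum_(x <- X) x %/ r %% t
    = \sum_(0 <= a < r) \sum_(0 <= c < t) c * m a c.
  under eq_bigr do rewrite modn_divl mulnC.
  rewrite -(@sum_count_fiber (fun x => x %% (r * t)) (fun b => b %/ r) (r * t));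
    last by move=> x; rewrite ltn_mod.
  rewrite blocks; apply: eq_big_nat => a /= a_lt; apply: eq_bigr => c _.
  by rewrite [_ %/ r](_ : _ = c) // addnC divnMDl // divn_small ?addn0.
rewrite blocks big_distrr -big_split /= !big_nat.
apply: leq_sum => a a_lt; rewrite (residue_split a a_lt).
exact: leq_bin2_sum.
Qed.

(** * Hook lengths and beads *)

(** The hook lengths of the first column: the shift by the number of rows below
    makes the entries distinct. *)
Fixpoint beads (la : seq nat) : seq nat :=
  if la is a :: la' then a + size la' :: beads la' else [::].

Definition column_length (la : seq nat) j := count (fun k => j < k) la.

Lemma diagram_cons a la :
  diagram (a :: la) = [seq (0, j) | j <- iota 0 a]
                      ++ [seq (b.1.+1, b.2) | b <- diagram la].
Proof.
rewrite /diagram /= -[1]addn0 iotaDl map_allpairs /=; congr (_ ++ _).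
by rewrite allpairs_mapl.
Qed.

Lemma count_column la j :
  count (fun c => c.2 == j) (diagram la) = column_length la j.
Proof.
elim: la => // a la IHla.
rewrite diagram_cons count_cat !count_map (eq_count (a2 := fun c => c.2 == j)) //.
rewrite IHla /column_length /=; congr (_ + _).
by rewrite (count_uniq_mem j (iota_uniq 0 a)) mem_iota.
Qed.

Lemma count_geq_iota a j : j < a -> count (leq j) (iota 0 a) = a - j.
Proof.
move=> lt_ja; have le_ja := ltnW lt_ja.
rewrite -{1}(subnKC le_ja) iotaD count_cat (eq_in_count (a2 := pred0)).
  rewrite count_pred0 add0n (eq_in_count (a2 := predT)) ?count_predT ?size_iota //.
  by move=> k; rewrite mem_iota => /andP[].
by move=> k; rewrite mem_iota /= => lt_kj; apply/negbTE; rewrite -ltnNge.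
Qed.

Lemma hook_length_first_row a la j : j < a ->
  hook_length (a :: la) (0, j) = a - j + column_length la j.
Proof.
move=> lt_ja; rewrite /hook_length /hook size_filter diagram_cons count_cat.
rewrite !count_map -count_column -(count_geq_iota lt_ja); congr (_ + _).
  by apply: eq_count => k /=; rewrite andbT; case: eqVneq => [->|]; rewrite ?leqnn ?orbF.
by apply: eq_count => c /=; rewrite andbT.
Qed.

Lemma hook_length_lower a la b :
  hook_length (a :: la) (b.1.+1, b.2) = hook_length la b.
Proof.
rewrite /hook_length /hook !size_filter diagram_cons count_cat !count_map.
rewrite (eq_count (a2 := pred0)) ?count_pred0 => [|k]; last by rewrite /= andbF.
by apply: eq_count => c; rewrite /= eqSS ltnS.
Qed.

(** Adding a row on top leaves the other hooks unchanged, which allows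
    induction on the number of rows. *)
Lemma hook_lengths_cons a la :
  hook_lengths (a :: la)
    = [seq a - j + column_length la j | j <- iota 0 a] ++ hook_lengths la.
Proof.
rewrite /hook_lengths diagram_cons map_cat -!map_comp; congr (_ ++ _).
  apply/eq_in_map => j; rewrite mem_iota => /= lt_ja.
  exact: hook_length_first_row.
by apply: eq_map => b; apply: hook_length_lower.
Qed.

(** The beads and gaps below the bead [x = a + size la] of a new top row.  The
    hook length at column [j] of that row is [x - (j + m)], where [m] is the
    number of lower rows that do not reach beyond column [j], so the second list
    consists of the numbers [x - h] for [h] a hook length in the top row.  When a
    row of length [b] is added to [la], the gaps of columns [j < b] stay in
    place, and those of columns [j >= b] fill the interval above the new
    bead. *)
Lemma beads_gaps a la : sorted geq (a :: la) ->
  perm_eq (beads la ++ [seq j + count (fun k => k <= j) la | j <- iota 0 a])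
          (iota 0 (a + size la)).
Proof.
elim: la a => [|b la IHla] a /=.
  by move=> _; rewrite addn0 (eq_map (g := id)) ?map_id // => j; rewrite /= addn0.
case/andP=> le_ba le_la; have perm_la := IHla b le_la.
rewrite -{1}(subnKC le_ba) (iotaD 0 b) map_cat add0n.
have -> : [seq j + ((b <= j) + count (fun k => k <= j) la) | j <- iota 0 b]
          = [seq j + count (fun k => k <= j) la | j <- iota 0 b].
  by apply/eq_in_map => j; rewrite mem_iota add0n => /= lt_jb; rewrite leqNgt lt_jb.
have -> : [seq j + ((b <= j) + count (fun k => k <= j) la) | j <- iota b (a - b)]
          = iota (b + size la).+1 (a - b).
  have -> : (b + size la).+1 = (size la).+1 + b by lia.
  rewrite iotaDl; apply/eq_in_map => j; rewrite mem_iota => /andP[le_bj _].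
  rewrite le_bj add1n addnC; congr (_.+1 + _); apply/eqP; rewrite -all_count.
  have geq_trans : transitive geq by move=> x y z le_xy /leq_trans; apply.
  have := order_path_min geq_trans le_la.
  by apply: sub_all => k /= /leq_trans; apply.
have -> : a + (size la).+1 = b + size la + (a - b).+1 by lia.
rewrite iotaD /= add0n.
rewrite catA -cat_cons -cat_rcons perm_cat2r perm_sym perm_rcons perm_cons.
by rewrite perm_sym.
Qed.

Lemma count_dvd_sub r x : count (fun y => r %| x - y) (iota 0 x) = x %/ r.
Proof.
rewrite divn_count_dvd -sum1_count big_mkcond big_add1 big_nat_rev /=.
rewrite /index_iota subn0 !big_seq; apply: eq_bigr => y.
rewrite mem_iota => /= lt_yx; rewrite add0n.
by have -> : (x - y.+1).+1 = x - y by lia.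
Qed.

(** Of the [x %/ r] numbers below the top bead [x] that are congruent to it
    modulo [r], those that are not beads give the hooks divisible by [r]. *)
Lemma count_dvd_first_row r a la : 0 < r -> sorted geq (a :: la) ->
  count (dvdn r) [seq a - j + column_length la j | j <- iota 0 a]
    + residue_count r (beads la) ((a + size la) %% r) = (a + size la) %/ r.
Proof.
move=> r_gt0 a_la; have perm_la := beads_gaps a_la; set x := a + size la.
rewrite -(count_dvd_sub r x) -(permP perm_la) count_cat count_map addnC.
rewrite count_map; congr (_ + _).
  apply: eq_in_count => y y_la; rewrite eq_sym eqn_mod_dvd //.
  have : y \in iota 0 x by rewrite -(perm_mem perm_la) mem_cat y_la.
  by rewrite mem_iota => /ltnW.
apply: eq_in_count => j; rewrite mem_iota => /= lt_ja; congr (_ %| _).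
rewrite /column_length /x -(count_predC (fun k => k <= j) la).
rewrite -(eq_count (a1 := predC (fun k => k <= j))); first by lia.
by move=> k /=; rewrite -ltnNge.
Qed.

(** The sum of binomials counts the pairs of beads in the same class modulo
    [r]; a new top bead adds its number of congruent beads to it. *)
Lemma count_dvd_hook_lengths r la : 0 < r -> sorted geq la ->
  count (dvdn r) (hook_lengths la)
    + \sum_(0 <= a < r) 'C(residue_count r (beads la) a, 2)
  = \sum_(x <- beads la) x %/ r.
Proof.
move=> r_gt0; elim: la => [|a la IHla] a_la.
  by rewrite big_nil big1.
have {}IHla := IHla (path_sorted a_la).
rewrite hook_lengths_cons count_cat /= big_cons -IHla.
rewrite -(count_dvd_first_row r_gt0 a_la) -!addnA; congr (_ + _).
rewrite addnCA; congr (_ + _).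
set x := a + size la; set M := residue_count r (beads la).
(* Up to conversion [(x %% r == c) + 0] is the count over the one-bead list [[:: x]]. *)
have -> : M (x %% r) = \sum_(0 <= c < r) M c * ((x %% r == c) + 0).
  rewrite (@sum_count_fiber (fun x => x %% r) M r [:: x]) ?big_seq1 //.
  by move=> y; rewrite ltn_mod.
rewrite -big_split /=; apply: eq_bigr => c _; rewrite addn0.
rewrite /residue_count /= -/(residue_count r (beads la) c) -/(M c).
by case: eqP => _; rewrite ?muln0 // muln1 add1n binS bin1 addnC.
Qed.

(** Both counts are sums over beads minus numbers of congruent pairs; after the
    division [x %/ r = t * (x %/ (r * t)) + x %/ r %% t] the multiples of
    [x %/ (r * t)] cancel and the bound on pairs remains. *)
Lemma count_dvd_hook_lengths_mul r t la : 0 < r -> 0 < t -> sorted geq la ->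
  t * count (dvdn (r * t)) (hook_lengths la)
    <= count (dvdn r) (hook_lengths la).
Proof.
move=> r_gt0 t_gt0 le_la; have rt_gt0 : 0 < r * t by rewrite muln_gt0 r_gt0.
have := count_dvd_hook_lengths r_gt0 le_la.
have := count_dvd_hook_lengths rt_gt0 le_la.
have := residue_pairs_refine (beads la) r_gt0 t_gt0.
have -> : \sum_(x <- beads la) x %/ r
    = t * \sum_(x <- beads la) x %/ (r * t) + \sum_(x <- beads la) x %/ r %% t.
  rewrite big_distrr -big_split; apply: eq_bigr => x _ /=.
  by rewrite divnMA mulnC -divn_eq.
nia.
Qed.

(** * Valuations of hook products *)

(** The range of summation depends only on [B], so that the valuations of
    different hook quotients can be added term by term. *)
Lemma logn_count_dvd_bound p n B : prime p -> 0 < n <= B ->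
  logn p n = \sum_(1 <= k < B) (p ^ k %| n).
Proof.
move=> p_pr /andP[n_gt0 le_nB].
rewrite (big_cat_nat n_gt0 le_nB) -logn_count_dvd //= big_nat big1 ?addn0 //.
move=> k /andP[le_nk _]; apply/eqP; rewrite eqb0 gtnNdvd //.
exact: leq_ltn_trans le_nk (ltn_expl k (prime_gt1 p_pr)).
Qed.

Lemma logn_prod_quotients p s (hs : seq nat) B : prime p -> 0 < s ->
    all (fun h => 0 < h <= B) hs ->
  logn p (\prod_(q <- [seq h %/ s | h <- hs & s %| h]) q)
    = \sum_(1 <= k < B) count (dvdn (s * p ^ k)) hs.
Proof.
move=> p_pr s_gt0; elim: hs => [|h hs IHhs] /=.
  by rewrite big_nil logn1 big1.
case/andP=> /andP[h_gt0 le_hB] hs_B; rewrite big_split /= -IHhs //.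
have [/dvdnP[q def_h] | s_h] := boolP (s %| h); last first.
  rewrite [X in X + _]big1 // => k _; apply/eqP; rewrite eqb0.
  by apply: contra s_h; apply: dvdn_trans; apply: dvdn_mulr.
have q_gt0 : 0 < q by rewrite def_h muln_gt0 in h_gt0; case/andP: h_gt0.
rewrite /= big_cons def_h mulnK // lognM //; last first.
  rewrite big_seq; apply: prodn_cond_gt0 => q' /mapP[h']; rewrite mem_filter.
  case/andP=> s_h' /(allP hs_B)/andP[h'_gt0 _] ->.
  by rewrite divn_gt0 // dvdn_leq.
congr (_ + _); rewrite (@logn_count_dvd_bound _ _ B) //.
  by apply: eq_bigr => k _; rewrite [q * s]mulnC dvdn_pmul2l.
by rewrite q_gt0 (leq_trans _ le_hB) // def_h leq_pmulr.
Qed.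

Lemma hook_prod_dvd s t la : 0 < s -> 0 < t -> sorted geq la ->
  hook_prod (s * t) la ^ t %| hook_prod s la.
Proof.
move=> s_gt0 t_gt0 le_la; have st_gt0 : 0 < s * t by rewrite muln_gt0 s_gt0.
have H_gt0 := hook_prod_gt0 la st_gt0.
apply/dvdn_partP; first by rewrite expn_gt0 H_gt0.
move=> p; rewrite mem_primes => /andP[p_pr _].
rewrite p_part pfactor_dvdn ?hook_prod_gt0 // lognX.
pose B := \sum_(h <- hook_lengths la) h.
have hooks_B : all (fun h => 0 < h <= B) (hook_lengths la).
  apply/allP => h h_la; rewrite /B (big_rem h) //= leq_addr andbT.
  by case/mapP: h_la => b b_la ->; apply: hook_length_gt0.
rewrite /hook_prod !(logn_prod_quotients p_pr _ hooks_B) // big_distrr /=.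
apply: leq_sum => k _; rewrite mulnAC.
apply: count_dvd_hook_lengths_mul => //.
by rewrite muln_gt0 s_gt0 expn_gt0 prime_gt0.
Qed.

Theorem theorem3 (s t : nat) (hs : 0 < s) (ht : 0 < t)
    (la : seq nat) (hla : is_partition la) :
  (((hook_prod s la)%:R / (hook_prod (s * t) la)%:R ^+ t : rat)
     \is a Num.int)%R.
Proof.
have /andP[le_la _] := hla.
have /dvdnP[q ->] := hook_prod_dvd hs ht le_la.
rewrite -GRing.natrX GRing.natrM GRing.mulfK ?Num.Theory.natr_int //.
by rewrite Num.Theory.pnatr_eq0 -lt0n expn_gt0 hook_prod_gt0 // muln_gt0 hs.
Qed.
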